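(* Let $(x_n)_{n\in\mathbb{N}}$ be a sequence in $[0,1)$. If $(x_n)_{n\in\mathbb{N}}$ has $\alpha$-pair correlations for some $0 < \alpha < 1$, then it is uniformly distributed.
   Context: Let $\|\cdot\|$ denote the distance to the nearest integer. For $0<\alpha<1$, a sequence $(x_n)_{n\in\mathbb{N}}$ in $[0,1)$ has $\alpha$-pair correlations if for all $s > 0$ $$\lim_{N\to\infty} \frac{1}{N^2}\, \frac{\#\{1 \le l \ne m \le N : \|x_l - x_m\| \le s N^{-\alpha}\}}{2sN^{-\alpha}} = 1,$$ where the pairs $(l,m)$ are ordered. A sequence in $[0,1)$ is uniformly distributed if $\frac1N \#\{1\le i\le N : x_i\in[a,b)\} \to b-a$ for all $0\le a<b\le 1$; equivalently, its discrepancy tends to $0$. *)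

(* Defs.v *)
From HB Require Import structures.
From mathcomp Require Import all_boot all_order all_algebra.
From mathcomp Require Import all_classical all_reals all_analysis.

Set Implicit Arguments.
Unset Strict Implicit.
Unset Printing Implicit Defensive.

Import Order.TTheory GRing.Theory Num.Theory.
Import numFieldNormedType.Exports.

Local Open Scope classical_set_scope.
Local Open Scope ring_scope.

Definition dist_int (R : realType) (t : R) : R :=
  inf [set `|t - m%:~R| | m in [set: int]].

(* Sequences are indexed from 0: the first N terms x_1, ..., x_N of the
   literature are [x i] for [i : 'I_N]. *)

Definition pair_count (R : realType) (x : nat -> R) (N : nat) (d : R) : nat :=
  #|[pred p : 'I_N * 'I_N |
      (p.1 != p.2) && (dist_int (x p.1 - x p.2) <= d)]|.

Definition has_pair_correlations (R : realType) (alpha : R) (x : nat -> R) :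
    Prop :=
  forall s : R, 0 < s ->
    (fun N : nat => 1 / N%:R ^+ 2 *
      ((pair_count x N (s * N%:R `^ (- alpha)))%:R /
       (2 * s * N%:R `^ (- alpha))) : R) @ \oo --> (1 : R).

Definition uniformly_distributed (R : realType) (x : nat -> R) : Prop :=
  forall a b : R, 0 <= a -> a < b -> b <= 1 ->
    (fun N : nat => 1 / N%:R * #|[pred i : 'I_N | a <= x i < b]|%:R : R) @ \oo
      --> (b - a : R).

(* Main.v *)
Require Import Defs.
From mathcomp Require Import all_boot all_order all_algebra.
From mathcomp Require Import all_classical all_reals all_analysis.
From mathcomp Require Import zify ring lra.
Import Order.TTheory GRing.Theory Num.Theory.
Import numFieldNormedType.Exports.
Local Open Scope classical_set_scope.
Local Open Scope ring_scope.

Set Implicit Arguments.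
Unset Strict Implicit.

(** Counting close pairs of points amounts to computing the second moment of
the number of points in a short moving window.  Correct pair correlations at
scale N^(-alpha) force this second moment to be asymptotically minimal, that is,
equal to the square of the mean; the points are then spread evenly over almost
all windows, hence over every interval.

The argument is run in a discrete form, which avoids integrating over s.  Fix
an integer K and cut [0,1) into M ~ K N^alpha bins.  A window consists of K
consecutive bins, so it has length about N^(-alpha), and W_j denotes the number
of points among the first N lying in the j-th window.  Windows may stick out of
[0,1) at either end, so that there are T = M + K of them and every point lies in
exactly K.  Hence the W_j sum to K N ([sum_window_count]).  Two points whose bins
are d apart share K - d windows, the number of k < K with d <= k; so the
sum of the W_j^2 is at most the sum over k < K of the number of pairs whose bins
are at most k apart ([sum_window_count_sqr]).  Such pairs are at distance at most
(k+1)/M <= ((k+1)/K) N^(-alpha), and the hypothesis with s = (k+1)/K gives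
  T (sum of W_j^2) / (sum of W_j)^2 <= 1 + 1/K + o(1),
which is [cvg_second_moment_bound].  The N diagonal pairs are negligible because
alpha < 1.

A ratio T (sum W_j^2) / (sum W_j)^2 close to 1 says that the W_j have small
variance relative to their mean, so each set of windows contains about its fair
share of the total ([subset_share_ge]).  Applied to the windows inside [a,b) this
gives the lower bound b - a for the limiting proportion of points in [a,b), up to
an error which vanishes with 1/K ([count_share_gt_eventually]).  The matching
upper bound needs no further estimate: the lower bound also holds for [0,a) and
[b,1), and the three proportions add up to 1. *)

(** * Moments of window counts *)

Definition window_count (I : finType) (c : I -> nat) (K j : nat) : nat :=
  #|[pred i | (c i <= j < c i + K)%N]|.

Lemma card_sum_nat_of_bool (I : finType) (P : pred I) :
  #|[pred i | P i]| = (\sum_i (P i : nat))%N.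
Proof. by rewrite -sum1_card big_mkcond /=; apply: eq_bigr => i _; rewrite inE; case: (P i). Qed.

Lemma sum_nat_interval (T m n : nat) :
  (\sum_(j < T) ((m <= j < n)%N : nat) = minn n T - m)%N.
Proof.
elim: T => [|T IH]; first by rewrite big_ord0 minn0.
by rewrite big_ord_recr /= IH; case: (boolP (m <= T < n)%N); lia.
Qed.

Section Windows.
Variables (I : finType) (c : I -> nat) (K T : nat).

Lemma sum_window_count : (forall i, (c i + K <= T)%N) ->
  (\sum_(j < T) window_count c K j = K * #|I|)%N.
Proof.
move=> cT; under eq_bigr do rewrite /window_count card_sum_nat_of_bool.
rewrite exchange_big /= mulnC -sum_nat_const; apply: eq_bigr => i _.
by rewrite sum_nat_interval; have := cT i; lia.
Qed.

(** The square of a window count counts the pairs of points that lie in that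
window.  Two points at bin distance d share at most K - d windows, and
K - d = #{k < K : d <= k}. *)
Lemma sum_window_count_sqr :
  (\sum_(j < T) window_count c K j ^ 2 <=
   \sum_(k < K) #|[pred p : I * I | (c p.1 <= c p.2 + k) && (c p.2 <= c p.1 + k)]|)%N.
Proof.
under eq_bigr do rewrite /window_count card_sum_nat_of_bool -mulnn big_distrlr
  pair_bigA /=.
under [leqRHS]eq_bigr do rewrite card_sum_nat_of_bool.
rewrite exchange_big [leqRHS]exchange_big /=; apply: leq_sum => -[i l] _ /=.
set a := c i; set b := c l.
rewrite (eq_bigr (fun j : 'I_T =>
    ((maxn a b <= j < minn (a + K) (b + K))%N : nat))); last first.
  by move=> j _; lia.
rewrite [leqRHS](eq_bigr (fun k : 'I_K =>
    ((maxn (a - b) (b - a) <= k < K)%N : nat))); last first.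
  by move=> k _; have := ltn_ord k; lia.
by rewrite !sum_nat_interval; lia.
Qed.

(** A point lies in at most K windows, and in none of those considered unless it
belongs to A. *)
Lemma sum_window_count_le (A : pred I) (p q : nat) :
  (forall i j, (p <= j < q)%N -> (c i <= j < c i + K)%N -> A i) ->
  (\sum_(j < T | p <= j < q) window_count c K j <= K * #|[pred i | A i]|)%N.
Proof.
move=> cA; under eq_bigr do rewrite /window_count card_sum_nat_of_bool.
rewrite exchange_big /= card_sum_nat_of_bool big_distrr /=.
apply: leq_sum => i _; case: (boolP (A i)) => [_|nAi].
  rewrite muln1 big_mkcond /=.
  apply: (@leq_trans (\sum_(j < T) ((c i <= j < c i + K)%N : nat))).
    by apply: leq_sum => j _; case: ifP.
  by rewrite sum_nat_interval; lia.
rewrite big1 // => j pq; case: (boolP (c i <= j < c i + K)%N) => // /(cA _ _ pq).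
by rewrite (negbTE nAi).
Qed.

End Windows.

Lemma card_diag_le (I : finType) (P : pred (I * I)) :
  (#|[pred p | P p]| <= #|I| + #|[pred p : I * I | (p.1 != p.2) && P p]|)%N.
Proof.
have -> : #|I| = (\sum_(p : I * I) ((p.1 == p.2) : nat))%N.
  rewrite -(pair_bigA _ (fun i l => (i == l) : nat)) /= -sum1_card.
  by apply: eq_bigr => i _; rewrite (bigD1 i) //= eqxx big1 // => l /negbTE; rewrite eq_sym => ->.
rewrite !card_sum_nat_of_bool -big_split /=.
by apply: leq_sum => p _; case: eqP; case: (P p).
Qed.

(** Each summand satisfies 1 - u <= e/2 + (u - 1)^2 / (2 e), by the inequality
between arithmetic and geometric means.  The right-hand side is nonnegative, so
its sum over J is at most its sum over all indices, where only the variance of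
the u_j about their mean 1 remains.  Minimising over e would give the bound of
Cauchy and Schwarz; leaving e free avoids a square root. *)
Lemma subset_sum_ge (R : realFieldType) (T : nat) (u : 'I_T -> R) (J : pred 'I_T)
    (e : R) : 0 < e -> \sum_j u j = T%:R ->
  \sum_(j | J j) (1 - u j) <= T%:R * e / 2 + (\sum_j u j ^+ 2 - T%:R) / (2 * e).
Proof.
move=> e0 uT.
apply: (@le_trans _ _ (\sum_j (e / 2 + (u j - 1) ^+ 2 / (2 * e)))).
  rewrite big_mkcond /=; apply: ler_sum => j _.
  have e2 : 0 < (2 * e)^-1 by rewrite invr_gt0 mulr_gt0.
  have s0 : 0 <= (u j - 1) ^+ 2 / (2 * e) by rewrite mulr_ge0 ?sqr_ge0// ltW.
  case: ifP => _; last by lra.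
  rewrite -subr_ge0.
  have -> : e / 2 + (u j - 1) ^+ 2 / (2 * e) - (1 - u j) =
            (u j - 1 + e) ^+ 2 / (2 * e) by field; lra.
  by rewrite mulr_ge0 ?sqr_ge0// ltW.
rewrite big_split /= sumr_const card_ord -mulr_suml.
under [X in _ + X / _ <= _]eq_bigr do rewrite sqrrB1.
rewrite big_split /= sumrB sumrMnl uT sumr_const card_ord.
rewrite le_eqVlt -[X in X + _]mulr_natr; apply/orP; left; apply/eqP.
by field; lra.
Qed.

(** The previous bound applied to the W_j rescaled to have mean 1. *)
Lemma subset_share_ge (R : realFieldType) (T : nat) (W : 'I_T -> R)
    (J : pred 'I_T) (e : R) : 0 < e -> 0 < \sum_j W j ->
  #|J|%:R / T%:R - e / 2
    - (T%:R * (\sum_j W j ^+ 2) / (\sum_j W j) ^+ 2 - 1) / (2 * e)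
  <= (\sum_(j | J j) W j) / \sum_j W j.
Proof.
move=> e0; set S := \sum_j W j => S0.
have T0 : 0 < T%:R :> R.
  rewrite ltr0n lt0n; apply: contraTneq S0 => T0.
  rewrite /S big1 ?ltxx// => j _; have := ltn_ord j.
  by rewrite {2}T0.
pose u j := T%:R / S * W j.
have uT : \sum_j u j = T%:R by rewrite -mulr_sumr -/S divfK// gt_eqF.
have := subset_sum_ge J e0 uT; rewrite sumrB sumr_const -mulr_sumr.
have -> : \sum_j u j ^+ 2 = (T%:R / S) ^+ 2 * \sum_j W j ^+ 2.
  by rewrite mulr_sumr; apply: eq_bigr => j _; rewrite exprMn.
set Q := \sum_j W j ^+ 2; set V := \sum_(j | J j) W j.
have Ti : 0 < (T%:R : R)^-1 by rewrite invr_gt0.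
move=> /(ler_wpM2l (ltW Ti)) H.
rewrite -subr_ge0 in H; rewrite -subr_ge0; apply: le_trans H _.
rewrite le_eqVlt; apply/orP; left; apply/eqP.
by field; rewrite ?(gt_eqF e0) ?(gt_eqF S0) ?(gt_eqF T0).
Qed.

(** * Points of the unit interval in bins *)

Lemma dist_int_le_norm (R : realType) (t : R) : dist_int t <= `|t|.
Proof.
apply: ge_inf; first by exists 0 => _ [m _ <-]; exact: normr_ge0.
by exists 0 => //; rewrite subr0.
Qed.

Lemma pair_count_le (R : realType) (x : nat -> R) (N : nat) (d d' : R) :
  d <= d' -> (pair_count x N d <= pair_count x N d')%N.
Proof.
move=> dd'; apply: subset_leq_card; apply/fintype.subsetP => p.
by rewrite !inE => /andP[-> /le_trans ->].
Qed.

Section Bins.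
Variables (R : realType) (x : nat -> R).
Hypothesis x_itv : forall n, 0 <= x n < 1.
Variables (N K M : nat).
Hypotheses (N0 : (0 < N)%N) (K0 : (0 < K)%N) (M0 : (0 < M)%N).

Let bin (i : 'I_N) : nat := Num.truncn (M%:R * x i).

Let bin_itv (i : 'I_N) : (bin i)%:R <= M%:R * x i < (bin i).+1%:R.
Proof. by apply: truncn_itv; rewrite mulr_ge0//; case/andP: (x_itv i). Qed.

Let bin_le (i : 'I_N) : (bin i + K <= M + K)%N.
Proof.
rewrite leq_add2r; apply: ltnW; rewrite -(ltr_nat R).
case/andP: (bin_itv i) => /le_lt_trans -> //.
by rewrite gtr_pMr ?ltr0n//; case/andP: (x_itv i).
Qed.

(* The diagonal pairs, which the pair count leaves out, contribute the
   summand N. *)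
Let near_bins_card (k : nat) :
  (#|[pred p : 'I_N * 'I_N | (bin p.1 <= bin p.2 + k) && (bin p.2 <= bin p.1 + k)]|
   <= N + pair_count x N (k.+1%:R / M%:R))%N.
Proof.
apply: leq_trans (card_diag_le _) _; rewrite card_ord leq_add2l.
apply: subset_leq_card; apply/fintype.subsetP => -[i l]; rewrite !inE /=.
case/andP=> -> /= /andP[il li]; apply: le_trans (dist_int_le_norm _) _.
have M0' : 0 < M%:R :> R by rewrite ltr0n.
rewrite ler_pdivlMr// -[X in _ * X]gtr0_norm// -normrM ler_norml.
have /andP[i1 i2] := bin_itv i; have /andP[l1 l2] := bin_itv l.
move: il li; rewrite -!(ler_nat R) !natrD => il li.
rewrite -!natr1 in i2 l2 *; rewrite mulrBl ![_ * M%:R]mulrC.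
by apply/andP; split; lra.
Qed.

(** The share bound of [subset_share_ge] for the windows contained in [a,b).
There are at least M (b - a) - (K + 1) of them: one of the K + 1 accounts for the
bin of b, and K for the windows that begin before the bin following that of a. *)
Lemma count_share_ge (a b e : R) : 0 <= a -> a <= b -> b <= 1 -> 0 < e ->
  (M%:R * (b - a) - K.+1%:R) / (M + K)%:R - e / 2
   - ((M + K)%:R * (\sum_(k < K) (N + pair_count x N (k.+1%:R / M%:R)))%:R
       / (K * N)%:R ^+ 2 - 1) / (2 * e)
  <= 1 / N%:R * #|[pred i : 'I_N | a <= x i < b]|%:R.
Proof.
move=> a0 ab b1 e0.
have M0' : 0 < M%:R :> R by rewrite ltr0n.
have N0' : 0 < N%:R :> R by rewrite ltr0n.
have K0' : 0 < K%:R :> R by rewrite ltr0n.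
have T0' : 0 < (M + K)%:R :> R by rewrite ltr0n addn_gt0 M0.
have /andP[p1 p2] := truncn_itv (mulr_ge0 (ltW M0') a0).
have /andP[q1 q2] := truncn_itv (mulr_ge0 (ltW M0') (le_trans a0 ab)).
set p := Num.truncn (M%:R * a) in p1 p2; set q := Num.truncn (M%:R * b) in q1 q2.
(* Window j consists of the bins j - K + 1, ..., j, hence lies inside [a,b) as
   soon as its first bin is beyond that of a and its last before that of b. *)
pose J (j : 'I_(M + K)) := (p + K <= j < q)%N.
pose W (j : 'I_(M + K)) : R := (window_count bin K j)%:R.
have WS : \sum_j W j = (K * N)%:R.
  by rewrite -natr_sum sum_window_count ?card_ord.
have S0 : 0 < \sum_j W j by rewrite WS ltr0n muln_gt0 K0.
have cardJ : M%:R * (b - a) - K.+1%:R <= #|J|%:R.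
  have -> : #|J| = (q - (p + K))%N.
    have qM : (q <= M)%N.
      by rewrite -(ler_nat R); apply: le_trans q1 _; rewrite ler_piMr// ltW.
    rewrite -[LHS](eq_card (A := [pred j | J j]))// card_sum_nat_of_bool.
    by rewrite sum_nat_interval; clear -qM; lia.
  apply: (@le_trans _ _ (q%:R - (p + K)%:R)).
    by rewrite -natr1 in q2; rewrite natrD -natr1; lra.
  by rewrite lerBlDr -natrD ler_nat; clear; lia.
apply: (le_trans _ (le_trans (subset_share_ge J e0 S0) _)).
  apply: lerB; first by rewrite lerD2r ler_wpM2r// invr_ge0 ltW.
  rewrite ler_wpM2r ?invr_ge0 ?mulr_ge0 ?(ltW e0)//.
  rewrite lerD2r WS ler_wpM2r ?invr_ge0 ?sqr_ge0// ler_wpM2l ?(ltW T0')//.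
  under eq_bigr do rewrite /W -natrX.
  rewrite -natr_sum ler_nat; apply: leq_trans (sum_window_count_sqr _ _ _) _.
  by apply: leq_sum => k _; exact: near_bins_card.
rewrite WS ler_pdivrMr ?ltr0n ?muln_gt0 ?K0// natrM.
have -> : forall z : R, 1 / N%:R * z * (K%:R * N%:R) = K%:R * z.
  by move=> z; field; rewrite gt_eqF.
rewrite -natr_sum -natrM ler_nat; apply: sum_window_count_le => i j pq ij.
have /andP[i1 i2] := bin_itv i.
have pi : (p.+1 <= bin i)%N by clear -pq ij; lia.
have iq : ((bin i).+1 <= q)%N by clear -pq ij; lia.
move: pi iq; rewrite -!(ler_nat R) => pi iq.
rewrite -(ler_pM2l M0') -(ltr_pM2l M0' (x i)).
by apply/andP; split; lra.
Qed.

End Bins.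

(** * Asymptotics of the second moment *)

Lemma cvg_natr_powRN (R : realType) (g : R) : 0 < g ->
  (N%:R `^ (- g)) @[N --> \oo] --> (0 : R).
Proof.
move=> g0; apply/cvgr0Pnorm_lt => e e0.
have e'0 : 0 < e^-1 by rewrite invr_gt0.
near=> N; rewrite ger0_norm ?powR_ge0// powRN.
rewrite -[ltRHS]invrK ltf_pV2 ?posrE ?powR_gt0//; last first.
  by rewrite ltr0n; near: N; exists 1%N.
have -> : e^-1 = (e^-1 `^ g^-1) `^ g.
  by rewrite -powRrM mulVf ?gt_eqF// powRr1// ltW.
apply: gt0_ltr_powR => //; rewrite ?nnegrE ?powR_ge0//.
near: N; exact: nbhs_infty_gtr.
Unshelve. all: by end_near. Qed.

Definition normalized_pair_count (R : realType) (alpha : R) (x : nat -> R)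
    (s : R) (N : nat) : R :=
  1 / N%:R ^+ 2 * ((pair_count x N (s * N%:R `^ (- alpha)))%:R /
    (2 * s * N%:R `^ (- alpha))).

(** An upper bound for T (sum W_j^2) / (sum W_j)^2: the first factor bounds
T N^(-alpha) / K; in the second factor, N^(-(1 - alpha)) comes from the diagonal
pairs and the sum from the pairs whose bins are at most k apart, for k < K. *)
Definition second_moment_bound (R : realType) (alpha : R) (x : nat -> R)
    (K N : nat) : R :=
  (1 + K.+1%:R / K%:R * N%:R `^ (- alpha)) *
  (N%:R `^ (- (1 - alpha)) +
   K%:R^-1 * \sum_(k < K) 2 * (k.+1%:R / K%:R) *
     normalized_pair_count alpha x (k.+1%:R / K%:R) N).

(** This average exceeds 1, its limiting value for large K, because bins at
distance k may contain points at distance close to (k+1)/M. *)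
Lemma sum_ramp (R : realType) (K : nat) : (0 < K)%N ->
  K%:R^-1 * (\sum_(k < K) 2 * (k.+1%:R / K%:R)) = 1 + K%:R^-1 :> R.
Proof.
move=> K0; have K0' : K%:R != 0 :> R by rewrite pnatr_eq0 -lt0n.
rewrite -mulr_sumr -mulr_suml.
have -> : \sum_(k < K) k.+1%:R = K%:R * (K%:R + 1) / 2 :> R.
  elim: K {K0 K0'} => [|K IH]; first by rewrite big_ord0 !mul0r.
  by rewrite big_ord_recr /= IH -natr1; field.
by field.
Qed.

Lemma cvg_second_moment_bound (R : realType) (alpha : R) (x : nat -> R) (K : nat) :
  0 < alpha < 1 -> (0 < K)%N -> has_pair_correlations alpha x ->
  second_moment_bound alpha x K N @[N --> \oo] --> (1 + K%:R^-1 : R).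
Proof.
move=> /andP[a0 a1] K0 pc.
have -> : 1 + K%:R^-1 = (1 + K.+1%:R / K%:R * 0) * (0 + K%:R^-1 *
    \sum_(k < K) 2 * (k.+1%:R / K%:R) * 1) :> R.
  by under eq_bigr do rewrite mulr1; rewrite sum_ramp// mulr0 addr0 mul1r add0r.
apply: cvgM.
  apply: cvgD; first exact: cvg_cst.
  by apply: cvgM; [exact: cvg_cst | exact: cvg_natr_powRN].
apply: cvgD; first by apply: cvg_natr_powRN; rewrite subr_gt0.
apply: cvgM; first exact: cvg_cst.
apply: cvg_big => [|k _]; first exact: add_continuous.
apply: cvgM; first exact: cvg_cst.
by apply: pc; rewrite divr_gt0 ?ltr0n.
Qed.

(** The finite bound with M chosen as the least integer above K N^alpha: then
(k+1)/M <= ((k+1)/K) N^(-alpha), so the pair counts are those at scale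
s = (k+1)/K. *)
Lemma count_share_ge_bound (R : realType) (alpha : R) (x : nat -> R)
    (x_itv : forall n, 0 <= x n < 1) (K N : nat) (a b e : R) :
  (0 < K)%N -> (0 < N)%N -> 0 <= a -> a <= b -> b <= 1 -> 0 < e ->
  (b - a) - (2 * K + 1)%N%:R / K%:R * N%:R `^ (- alpha) - e / 2
    - (second_moment_bound alpha x K N - 1) / (2 * e)
  <= 1 / N%:R * #|[pred i : 'I_N | a <= x i < b]|%:R.
Proof.
move=> K0 N0 a0 ab b1 e0.
have K0' : 0 < K%:R :> R by rewrite ltr0n.
have N0' : 0 < N%:R :> R by rewrite ltr0n.
have y0 : 0 < N%:R `^ (- alpha) :> R by rewrite powR_gt0.
have yy : N%:R `^ (- (1 - alpha)) = (N%:R * N%:R `^ (- alpha))^-1 :> R.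
  rewrite opprB powRB; last by rewrite (gt_eqF N0') implybT.
  by rewrite powRr1 ?(ltW N0')// powRN invfM invrK mulrC.
pose F k := normalized_pair_count alpha x (k.+1%:R / K%:R) N.
have FE k : (pair_count x N (k.+1%:R / K%:R * N%:R `^ (- alpha)))%:R =
    N%:R ^+ 2 * (2 * (k.+1%:R / K%:R) * F k) * N%:R `^ (- alpha).
  rewrite /F /normalized_pair_count; set y := _ `^ _ in y0 *.
  have : k.+1%:R != 0 :> R by rewrite pnatr_eq0.
  by move: (k.+1%:R : R) => z z0; field; rewrite z0 !gt_eqF.
rewrite /second_moment_bound -/(F _) yy.
under eq_bigr do rewrite -/(F _).
set y := _ `^ _ in y0 yy FE *.
set M := (Num.truncn (K%:R / y)).+1.
have /andP[M1 M2] := truncn_itv (divr_ge0 (ltW K0') (ltW y0)).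
rewrite -/M in M2; have M3 : M%:R <= K%:R / y + 1 by rewrite -natr1 lerD2r.
have M0' : 0 < M%:R :> R by rewrite ltr0n.
have T0' : 0 < (M + K)%:R :> R by rewrite ltr0n addn_gt0.
apply: le_trans (count_share_ge x_itv N0 K0 (ltn0Sn _ : (0 < M)%N) a0 ab b1 e0).
apply: lerB; first rewrite lerD2r.
  (* Replacing M by M + K in the main term costs at most K, on top of K + 1;
     and M + K >= K / y. *)
  have KyT : K%:R <= y * (M + K)%:R.
    rewrite mulrC -ler_pdivrMr//; apply: le_trans (ltW M2) _.
    by rewrite ler_nat leq_addr.
  rewrite ler_pdivlMr// -subr_ge0.
  have -> : M%:R * (b - a) - K.+1%:R
      - (b - a - (2 * K + 1)%N%:R / K%:R * y) * (M + K)%:R =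
      (2 * K + 1)%N%:R / K%:R * (y * (M + K)%:R - K%:R) + K%:R * (1 - (b - a)).
    by rewrite -natr1 !natrD; field; rewrite gt_eqF.
  by rewrite addr_ge0// mulr_ge0 ?divr_ge0 ?subr_ge0 ?(ltW K0')//; lra.
rewrite ler_wpM2r ?invr_ge0 ?mulr_ge0 ?(ltW e0)// lerD2r.
have Mi : M%:R^-1 <= K%:R^-1 * y.
  by rewrite -[y]invrK -invfM lef_pV2 ?posrE ?divr_gt0// ltW.
set S := \sum_(k < K) _ * F k.
have Q0 : (\sum_(k < K) (N + pair_count x N (k.+1%:R / M%:R)))%:R <=
    K%:R * N%:R + N%:R ^+ 2 * S * y.
  rewrite big_split /= sum_nat_const card_ord natrD natrM lerD2l.
  rewrite natr_sum mulr_sumr mulr_suml; apply: ler_sum => k _.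
  rewrite -FE ler_nat; apply: pair_count_le.
  by rewrite -mulrA ler_wpM2l.
have -> : (1 + K.+1%:R / K%:R * y) * ((N%:R * y)^-1 + K%:R^-1 * S) =
  (K%:R / y + 1 + K%:R) * (K%:R * N%:R + N%:R ^+ 2 * S * y) / (K * N)%:R ^+ 2.
  by rewrite -natr1 natrM; field; rewrite !gt_eqF.
rewrite ler_wpM2r ?invr_ge0 ?sqr_ge0//; apply: ler_pM => //.
by rewrite natrD lerD2r.
Qed.

(** With e the prescribed error, the bound tends to b - a - e/2 - 1/(2 K e), and
K > e^(-2) makes e/2 + 1/(2 K e) smaller than e. *)
Lemma count_share_gt_eventually (R : realType) (alpha : R) (x : nat -> R) (a b e : R) :
  (forall n, 0 <= x n < 1) -> 0 < alpha < 1 -> has_pair_correlations alpha x ->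
  0 <= a -> a <= b -> b <= 1 -> 0 < e ->
  \forall N \near \oo, b - a - e < 1 / N%:R * #|[pred i : 'I_N | a <= x i < b]|%:R.
Proof.
move=> x_itv a01 pc a0 ab b1 e0.
pose K := (Num.truncn (e ^- 2)).+1.
have Ke : K%:R^-1 < e ^+ 2.
  rewrite -[ltRHS]invrK ltf_pV2 ?posrE ?invr_gt0 ?exprn_gt0 ?ltr0n//.
  exact: truncnS_gt.
have L : ((b - a) - (2 * K + 1)%N%:R / K%:R * N%:R `^ (- alpha) - e / 2
    - (second_moment_bound alpha x K N - 1) / (2 * e)) @[N --> \oo] -->
   (b - a - (2 * K + 1)%N%:R / K%:R * 0 - e / 2 - (1 + K%:R^-1 - 1) / (2 * e) : R).
  apply: cvgB.
    apply: cvgB; last exact: cvg_cst.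
    apply: cvgB; first exact: cvg_cst.
    apply: cvgM; first exact: cvg_cst.
    by apply: cvg_natr_powRN; case/andP: a01.
  apply: cvgM; last exact: cvg_cst.
  apply: cvgB; last exact: cvg_cst.
  exact: cvg_second_moment_bound.
near=> N.
apply: lt_le_trans (@count_share_ge_bound _ alpha _ x_itv K _ _ _ e _ _ _ _ _ _) => //.
  near: N; apply: cvgr_gt L _ _.
  have : K%:R^-1 / (2 * e) < e / 2.
    rewrite ltr_pdivrMr ?mulr_gt0//; apply: (lt_le_trans Ke).
    by rewrite le_eqVlt; apply/orP; left; apply/eqP; field.
  rewrite mulr0 subr0 (addrC 1) addrK.
  by move: (K%:R^-1 / (2 * e)) => z; lra.
by near: N; exists 1%N.
Unshelve. all: by end_near. Qed.

Unset Implicit Arguments.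

Theorem corollary1p5 (R : realType) (x : nat -> R)
  (x_itv : forall n : nat, 0 <= x n < 1)
  (x_pc : exists alpha : R, 0 < alpha < 1 /\ has_pair_correlations alpha x) :
  uniformly_distributed x.
Proof.
case: x_pc => alpha [a01 pc] a b a0 ab b1.
have share u v := @count_share_gt_eventually _ _ _ u v _ x_itv a01 pc.
apply/cvgrPdist_lt => e e0; have e2 : 0 < e / 2 by rewrite divr_gt0.
near=> N.
have N0 : 0 < N%:R :> R by rewrite ltr0n; near: N; exists 1%N.
have s1 : a - 0 - e / 2 < 1 / N%:R * #|[pred i : 'I_N | 0 <= x i < a]|%:R.
  by near: N; apply: share => //; lra.
have s2 : b - a - e / 2 < 1 / N%:R * #|[pred i : 'I_N | a <= x i < b]|%:R.
  by near: N; apply: share => //; lra.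
have s3 : 1 - b - e / 2 < 1 / N%:R * #|[pred i : 'I_N | b <= x i < 1]|%:R.
  by near: N; apply: share => //; lra.
have total : 1 / N%:R * #|[pred i : 'I_N | 0 <= x i < a]|%:R +
    1 / N%:R * #|[pred i : 'I_N | a <= x i < b]|%:R +
    1 / N%:R * #|[pred i : 'I_N | b <= x i < 1]|%:R = 1 :> R.
  rewrite -!mulrDr -!natrD.
  rewrite !card_sum_nat_of_bool -!big_split /=.
  rewrite (eq_bigr (fun=> 1%N)); last first.
    move=> i _; have /andP[-> ->] := x_itv i; rewrite andbT /=.
    case: (ltrP (x i) a) => xa; case: (ltrP (x i) b) => xb //; exfalso; lra.
  rewrite sum1_card card_ord.
  by rewrite mul1r mulVf// gt_eqF.
rewrite ltr_norml; apply/andP; split; lra.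
Unshelve. all: by end_near. Qed.
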